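(* ČF$T_2$ is a fuzzy closure property: if $\theta:(X,c)\to(Y,d)$ is a ČF-homeomorphism between fuzzy closure spaces and $(X,c)$ is ČF$T_2$, then $(Y,d)$ is ČF$T_2$.
   Context: $I=[0,1]$; a fuzzy (sub)set of a non-empty set $X$ is a map $f:X\to I$, and $I^X$ is the set of all of them, ordered pointwise, with $\vee,\wedge$ pointwise supremum/infimum. $\underline 0$ is the constant $0$ fuzzy set; the complement is $\mathfrak{Co}(f)(x)=1-f(x)$. For $x\in X$ and $0<\lambda\le1$, the fuzzy point $x_\lambda$ has value $\lambda$ at $x$ and $0$ elsewhere; $x_\lambda\in f$ means $x_\lambda\le f$, i.e. $\lambda\le f(x)$. Fuzzy points $x_\lambda,y_\gamma$ are distinct if $x\ne y$. A fuzzy closure space is a pair $(X,c)$ with $X$ a non-empty set and $c:I^X\to I^X$ satisfying $c(\underline 0)=\underline 0$, $f\le c(f)$, and $c(f\vee g)=c(f)\vee c(g)$ for all $f,g\in I^X$ (idempotency is not required). For $\theta:X\to Y$ and $f\in I^X$, $\theta(f)(y)=\sup\{f(x):\theta(x)=y\}$ if $\theta^{-1}(y)\ne\emptyset$, and $0$ otherwise. $\theta:(X,c)\to(Y,d)$ is ČF-continuous if $\theta(c(f))\le d(\theta(f))$ for all $f\in I^X$; it is a ČF-homeomorphism if it is bijective and both $\theta$ and $\theta^{-1}$ are ČF-continuous. A fuzzy closure property is a property of fuzzy closure spaces preserved by ČF-homeomorphisms. The interior is $\operatorname{int}(f)=\mathfrak{Co}(c(\mathfrak{Co}(f)))$; $f$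 is a neighborhood of a fuzzy point $x_\lambda$ if $x_\lambda\le\operatorname{int}(f)$. $(X,c)$ is ČF$T_2$ if for every two distinct fuzzy points $x_\lambda,y_\gamma$ there are neighborhoods $f$ of $x_\lambda$ and $g$ of $y_\gamma$ such that $f\le\mathfrak{Co}(g)$, $x_\lambda\in f\le\mathfrak{Co}(y_\gamma)$ and $y_\gamma\in g\le\mathfrak{Co}(x_\lambda)$. *)

(* Defs.v *)
From HB Require Import structures.
From mathcomp Require Import all_boot all_order all_algebra.
From mathcomp Require Import boolp classical_sets reals interval_inference.

Set Implicit Arguments.
Unset Strict Implicit.
Unset Printing Implicit Defensive.

Import Order.TTheory GRing.Theory Num.Theory.

Local Open Scope classical_set_scope.
Local Open Scope ring_scope.

(* Since [{i01 R}] is totally ordered, [boolp] equips fuzzy sets with the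
   pointwise order [<=%O] and the pointwise join [`|`%O]. *)
Definition fuzzy_set (R : realType) (X : Type) : Type := X -> {i01 R}.

Section FuzzySets.
Context {R : realType}.
Implicit Types X Y : Type.

Definition fuzzy0 X : fuzzy_set R X := fun=> 0%:i01.

Definition fuzzy_compl X (f : fuzzy_set R X) : fuzzy_set R X :=
  fun x => (1 - (f x)%:num)%:i01.

(* A genuine fuzzy point only when [0 < l], which is required where fuzzy
   points are quantified over, in [CFT2]. *)
Definition fuzzy_point X (x : X) (l : {i01 R}) : fuzzy_set R X :=
  fun z => if `[< z = x >] then l else 0%:i01.

Definition fuzzy_mem X (x : X) (l : {i01 R}) (f : fuzzy_set R X) : Prop :=
  (fuzzy_point x l <= f)%O.

Definition fuzzy_image_val X Y (theta : X -> Y) (f : fuzzy_set R X) (y : Y) : R :=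
  if `[< exists x, theta x = y >]
  then sup [set r : R | exists2 x, theta x = y & (f x)%:num = r]
  else 0.

Lemma fuzzy_image_val_ge0 X Y (theta : X -> Y) (f : fuzzy_set R X) (y : Y) :
  0 <= fuzzy_image_val theta f y.
Proof.
rewrite /fuzzy_image_val; case: asboolP => // -[x xy].
apply: (@le_trans _ _ (f x)%:num); first exact: ge0.
apply: ub_le_sup; last by exists x.
by exists 1 => _ [z _ <-]; apply: le1.
Qed.

Lemma fuzzy_image_val_le1 X Y (theta : X -> Y) (f : fuzzy_set R X) (y : Y) :
  fuzzy_image_val theta f y <= 1.
Proof.
rewrite /fuzzy_image_val; case: asboolP => // -[x xy].
by apply: ge_sup => [|_ [z _ <-]]; [exists (f x)%:num, x | apply: le1].
Qed.

Definition fuzzy_image X Y (theta : X -> Y) (f : fuzzy_set R X) :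
    fuzzy_set R Y :=
  fun y => Itv01 (fuzzy_image_val_ge0 theta f y) (fuzzy_image_val_le1 theta f y).

End FuzzySets.

Record fuzzy_closure_space (R : realType) := FuzzyClosureSpace {
  carrier :> Type;
  carrier_inhabited : inhabited carrier;
  fcl : fuzzy_set R carrier -> fuzzy_set R carrier;
  fcl0 : fcl (@fuzzy0 R carrier) = @fuzzy0 R carrier;
  fcl_ge : forall f : fuzzy_set R carrier, (f <= fcl f)%O;
  fclU : forall f g : fuzzy_set R carrier,
    fcl (f `|` g)%O = (fcl f `|` fcl g)%O
}.

Section FuzzyClosureSpaces.
Context {R : realType}.
Implicit Types X Y : fuzzy_closure_space R.

Definition CF_continuous X Y (theta : X -> Y) : Prop :=
  forall f : fuzzy_set R X,
    (fuzzy_image theta (fcl f) <= fcl (fuzzy_image theta f))%O.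

Definition CF_homeomorphism X Y (theta : X -> Y) : Prop :=
  exists theta_inv : Y -> X,
    [/\ cancel theta theta_inv, cancel theta_inv theta,
        CF_continuous theta & CF_continuous theta_inv].

Definition fuzzy_closure_property (P : fuzzy_closure_space R -> Prop) : Prop :=
  forall (X Y : fuzzy_closure_space R) (theta : X -> Y),
    CF_homeomorphism theta -> P X -> P Y.

Definition fuzzy_interior X (f : fuzzy_set R X) : fuzzy_set R X :=
  fuzzy_compl (fcl (fuzzy_compl f)).

Definition fuzzy_nbhs X (x : X) (l : {i01 R}) (f : fuzzy_set R X) : Prop :=
  (fuzzy_point x l <= fuzzy_interior f)%O.

Definition CFT2 X : Prop :=
  forall (x y : X) (l m : {i01 R}), 0 < l%:num -> 0 < m%:num -> x <> y ->
  exists f g : fuzzy_set R X,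
    [/\ fuzzy_nbhs x l f /\ fuzzy_nbhs y m g,
        (f <= fuzzy_compl g)%O,
        fuzzy_mem x l f /\ (f <= fuzzy_compl (fuzzy_point y m))%O &
        fuzzy_mem y m g /\ (g <= fuzzy_compl (fuzzy_point x l))%O].

End FuzzyClosureSpaces.

(* Main.v *)
Require Import Defs.
From mathcomp Require Import all_boot all_order all_algebra.
From mathcomp Require Import boolp classical_sets reals interval_inference.

(** The image of a fuzzy set under a bijection is precomposition with the
    inverse, so a ČF-homeomorphism makes precomposition with its inverse commute
    with closures, hence with interiors; this transports separating
    neighborhoods from [X] to [Y]. *)

Set Implicit Arguments.
Unset Strict Implicit.
Unset Printing Implicit Defensive.

Import Order.TTheory GRing.Theory Num.Theory.

Local Open Scope classical_set_scope.
Local Open Scope ring_scope.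

Section Transport.
Context {R : realType}.

(** The fibre over [y] is the singleton of [theta_inv y], so the supremum ranges over a single value
    and the default [0] never occurs. *)
Lemma fuzzy_image_can X Y (theta : X -> Y) (theta_inv : Y -> X)
    (f : fuzzy_set R X) :
  cancel theta theta_inv -> cancel theta_inv theta ->
  fuzzy_image theta f = f \o theta_inv.
Proof.
move=> thetaK theta_invK; apply/funext => y; apply/val_inj => /=.
rewrite /fuzzy_image_val asboolT; last by exists (theta_inv y).
rewrite (_ : [set r | _] = [set (f (theta_inv y))%:num]) ?sup1//.
apply/seteqP; split=> [_ [x <- <-]|_ ->] /=; first by rewrite thetaK.
by exists (theta_inv y).
Qed.

Lemma fuzzy_point_can X Y (theta : X -> Y) (theta_inv : Y -> X) (y : Y)
    (l : {i01 R}) :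
  cancel theta_inv theta ->
  fuzzy_point y l = fuzzy_point (theta_inv y) l \o theta_inv.
Proof.
move=> theta_invK; apply/funext => z; rewrite /fuzzy_point /=.
congr (if _ then _ else _); apply: asbool_equiv_eq; split=> [->//|].
exact: (can_inj theta_invK).
Qed.

Lemma fuzzy_le_comp X Y (h : Y -> X) (f g : fuzzy_set R X) :
  (f <= g)%O -> ((f \o h : fuzzy_set R Y) <= g \o h)%O.
Proof. by move=> /lefP fg; apply/lefP => y; apply: fg. Qed.

(** Each inequality comes from the continuity of one of the two maps. *)
Lemma fcl_comp_can (X Y : fuzzy_closure_space R) (theta : X -> Y)
    (theta_inv : Y -> X) (f : fuzzy_set R X) :
  cancel theta theta_inv -> cancel theta_inv theta ->
  CF_continuous theta -> CF_continuous theta_inv ->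
  fcl (f \o theta_inv : fuzzy_set R Y) = fcl f \o theta_inv.
Proof.
move=> thetaK theta_invK thetaC theta_invC; apply/le_anti/andP; split.
(* Continuity of [theta_inv] yields [fcl (f \o theta_inv) \o theta <= fcl f]; precomposing with
   [theta_inv] cancels [theta]. *)
- have := theta_invC (f \o theta_inv).
  rewrite !(fuzzy_image_can _ theta_invK thetaK).
  rewrite (_ : (f \o theta_inv) \o theta = f); last first.
    by apply/funext => x /=; rewrite thetaK.
  move=> /(fuzzy_le_comp theta_inv).
  rewrite (_ : (_ \o theta) \o theta_inv = fcl (f \o theta_inv))//.
  by apply/funext => y /=; rewrite theta_invK.
- by have := thetaC f; rewrite !(fuzzy_image_can _ thetaK theta_invK).
Qed.

End Transport.

Theorem theorem6p4 (R : realType) : fuzzy_closure_property (@CFT2 R).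
Proof.
move=> X Y theta [theta_inv [thetaK theta_invK thetaC theta_invC]] XT2.
move=> x y l m l0 m0 xy.
have [|f [g [[nf ng] fg [lf fm] [mg gl]]]] :=
  XT2 (theta_inv x) (theta_inv y) l m l0 m0.
  by move=> /(can_inj theta_invK).
have intE (h : fuzzy_set R X) :
    fuzzy_interior (h \o theta_inv : fuzzy_set R Y) =
    fuzzy_interior h \o theta_inv.
  rewrite /fuzzy_interior.
  (* Complements are pointwise, so they commute with precomposition by computation; only the closure
     needs the homeomorphism. *)
  have := fcl_comp_can (fuzzy_compl h) thetaK theta_invK thetaC theta_invC.
  by rewrite /fuzzy_compl /comp => ->.
exists (f \o theta_inv), (g \o theta_inv).
rewrite /fuzzy_nbhs /fuzzy_mem !intE.
(* With the fuzzy points also written as composites with [theta_inv], every remaining inequality is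
   one from [X] precomposed with [theta_inv]. *)
rewrite (fuzzy_point_can x l theta_invK) (fuzzy_point_can y m theta_invK).
split.
- by split; [exact: fuzzy_le_comp nf|exact: fuzzy_le_comp ng].
- exact: fuzzy_le_comp fg.
- by split; [exact: fuzzy_le_comp lf|exact: fuzzy_le_comp fm].
- by split; [exact: fuzzy_le_comp mg|exact: fuzzy_le_comp gl].
Qed.
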